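(* Let $D\subset\mathbb R^2$ be a simply connected bounded domain containing the origin and let $k\ge 2$ be an integer. Then the polynomial complex $$\boldsymbol{RT}\xrightarrow{\ \subset\ }\mathbb P_{k+1}(D;\mathbb R^2)\xrightarrow{\ \operatorname{sym}\operatorname{curl}\ }\mathbb P_k(D;\mathbb S)\xrightarrow{\ \operatorname{div}\operatorname{div}\ }\mathbb P_{k-2}(D)\longrightarrow 0$$ is exact, i.e. it is a complex, the kernel of $\operatorname{sym}\operatorname{curl}$ on $\mathbb P_{k+1}(D;\mathbb R^2)$ is $\boldsymbol{RT}$, the kernel of $\operatorname{div}\operatorname{div}$ on $\mathbb P_k(D;\mathbb S)$ is $\operatorname{sym}\operatorname{curl}\mathbb P_{k+1}(D;\mathbb R^2)$, and $\operatorname{div}\operatorname{div}:\mathbb P_k(D;\mathbb S)\to\mathbb P_{k-2}(D)$ is surjective.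
   Context: $\mathbb S$ is the space of symmetric real $2\times2$ matrices; $\mathbb P_m(D;\mathbb X)$ is the space of $\mathbb X$-valued polynomials of total degree at most $m$ on $D$. $\boldsymbol{RT}=\{\boldsymbol a+b\boldsymbol x:\boldsymbol a\in\mathbb R^2,b\in\mathbb R\}$ (lowest order Raviart-Thomas space). For scalar $\phi$, $\operatorname{curl}\phi=(\partial_{x_2}\phi,-\partial_{x_1}\phi)^{\intercal}$; for a vector field $\boldsymbol v$, $\operatorname{curl}\boldsymbol v$ is the matrix obtained by applying $\operatorname{curl}$ row-wise, and $\operatorname{sym}\operatorname{curl}\boldsymbol v=\frac12(\operatorname{curl}\boldsymbol v+(\operatorname{curl}\boldsymbol v)^{\intercal})$. $\operatorname{div}$ of a matrix field is the vector field obtained row-wise. *)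

(* Defs.v *)
From HB Require Import structures.
From mathcomp Require Import all_boot all_order all_algebra.
From mathcomp Require Import all_classical all_reals all_analysis.

Set Implicit Arguments.
Unset Strict Implicit.
Unset Printing Implicit Defensive.

Import Order.TTheory GRing.Theory Num.Theory.
Import numFieldNormedType.Exports.

Local Open Scope classical_set_scope.
Local Open Scope ring_scope.

(* Points and vectors of R^2 are columns; the coordinates x_1, x_2 are
   [x 0 0], [x 1 0].

   A field on D is represented by a total function on R^2, and fields are only
   ever compared on D ([{in D, f =1 g}]); the sets of fields below are saturated
   for this relation.  As D is open, derivatives at points of D do not depend on
   the values outside D. *)

Section Domains.
Variable R : realType.
Variable T : topologicalType.

Definition path_connected (A : set T) : Prop :=
  forall x y, A x -> A y -> exists p : R -> T,
    [/\ {within `[0, 1], continuous p}, p @` `[0, 1] `<=` A, p 0 = x & p 1 = y].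

Definition null_homotopic_in (A : set T) (p : R -> T) : Prop :=
  exists H : R * R -> T,
    [/\ {within `[0, 1] `*` `[0, 1], continuous H},
        H @` (`[0, 1] `*` `[0, 1]) `<=` A,
        forall s : R, s \in `[0, 1] -> H (s, 0) = p s /\ H (s, 1) = p 0
      & forall t : R, t \in `[0, 1] -> H (0, t) = p 0 /\ H (1, t) = p 0].

Definition simply_connected (A : set T) : Prop :=
  path_connected A /\
  forall p : R -> T, {within `[0, 1], continuous p} ->
    p @` `[0, 1] `<=` A -> p 0 = p 1 -> null_homotopic_in A p.

Definition domain (A : set T) : Prop := [/\ open A, connected A & A !=set0].

End Domains.

Section Fields.
Variable R : realType.
Implicit Types D : set 'cV[R]_2.

Definition symmetric_matrices : set 'M[R]_2 := [set A : 'M[R]_2 | A \is symmetricmx].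

(* X-valued polynomials of total degree at most m: the coefficients lie in X,
   which is meant to be a linear subspace of V. *)
Definition PolyOn (V : lmodType R) (m : nat) D (X : set V) : set ('cV[R]_2 -> V) :=
  [set f : 'cV[R]_2 -> V | exists c : nat -> nat -> V,
     (forall i j, X (c i j)) /\
     {in D, f =1 fun x => \sum_(i < m.+1) \sum_(j < m.+1 | (i + j <= m)%N)
                            (x 0 0 ^+ i * x 1 0 ^+ j) *: c i j}].

Definition RT D : set ('cV[R]_2 -> 'cV[R]_2) :=
  [set v : 'cV[R]_2 -> 'cV[R]_2 | exists (a : 'cV[R]_2) (b : R), {in D, v =1 fun x => a + b *: x}].

Definition partial (j : 'I_2) (f : 'cV[R]_2 -> R) (x : 'cV[R]_2) : R :=
  'D_(delta_mx j 0) f x.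

Definition curl (f : 'cV[R]_2 -> R) (x : 'cV[R]_2) : 'cV[R]_2 :=
  \col_i (if i == 0 then partial 1 f x else - partial 0 f x).

Definition curl_rows (v : 'cV[R]_2 -> 'cV[R]_2) (x : 'cV[R]_2) : 'M[R]_2 :=
  \matrix_(i, j) curl (fun y => v y i 0) x j 0.

Definition sym_curl (v : 'cV[R]_2 -> 'cV[R]_2) (x : 'cV[R]_2) : 'M[R]_2 :=
  2^-1 *: (curl_rows v x + (curl_rows v x)^T).

Definition div (v : 'cV[R]_2 -> 'cV[R]_2) (x : 'cV[R]_2) : R :=
  \sum_j partial j (fun y => v y j 0) x.

Definition div_rows (tau : 'cV[R]_2 -> 'M[R]_2) (x : 'cV[R]_2) : 'cV[R]_2 :=
  \col_i div (fun y => (row i (tau y))^T) x.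

Definition div_div (tau : 'cV[R]_2 -> 'M[R]_2) : 'cV[R]_2 -> R :=
  div (div_rows tau).

Definition kernel_on (V W : lmodType R) D (P : set ('cV[R]_2 -> V))
    (L : ('cV[R]_2 -> V) -> 'cV[R]_2 -> W) : set ('cV[R]_2 -> V) :=
  [set f : 'cV[R]_2 -> V | P f /\ {in D, L f =1 fun=> 0}].

Definition range_on (V W : lmodType R) D (P : set ('cV[R]_2 -> V))
    (L : ('cV[R]_2 -> V) -> 'cV[R]_2 -> W) : set ('cV[R]_2 -> W) :=
  [set g : 'cV[R]_2 -> W | exists2 f, P f & {in D, g =1 L f}].

End Fields.

(* Main.v *)
(* On an open set containing the origin a polynomial is determined by its
   coefficients, which are read off from the iterated partial derivatives at the
   origin.  All operators thus become explicit operators on coefficients and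
   exactness reduces to solving linear recurrences. *)
Require Import Defs.
From HB Require Import structures.
From mathcomp Require Import all_boot all_order all_algebra.
From mathcomp Require Import all_classical all_reals all_analysis.
From mathcomp Require Import ring lra zify.
Import Order.TTheory GRing.Theory Num.Theory.
Import numFieldNormedType.Exports.

Local Open Scope classical_set_scope.
Local Open Scope ring_scope.

(** * Bivariate polynomials: derivatives and uniqueness of coefficients *)

Lemma is_derive_coord {R : realType} (a : 'I_2) (x v : 'cV[R]_2) :
  is_derive x v (fun y : 'cV[R]_2 => y a 0) (v a 0).
Proof.
have E : \forall h \near (0 : R)^',
    h^-1 *: (((fun y : 'cV[R]_2 => y a 0) \o shift x) (h *: v) - x a 0) = v a 0.
  near=> h; rewrite /= !mxE addrK /GRing.scale /= mulrA mulVf ?mul1r//.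
  by near: h; exact: nbhs_dnbhs_neq.
split; first by apply/cvg_ex; exists (v a 0); exact: cvg_near_cst.
by apply: cvg_lim => //; exact: cvg_near_cst.
Unshelve. all: by end_near. Qed.

Lemma ord2P (a : 'I_2) : a = 0 \/ a = 1.
Proof. by case: a => -[|[|//]] ?; [left|right]; apply: val_inj. Qed.

Lemma sum_ord2 (V : nmodType) (F : 'I_2 -> V) : \sum_a F a = F 0 + F 1.
Proof. by rewrite big_ord_recl big_ord1; congr (F _ + F _); apply: val_inj. Qed.

(** The coefficient family is indexed by all pairs, so operators on coefficients need not track the
    degree; the truncation sits in the sum alone. *)
Definition poly2 {R : realType} (m : nat) (c : nat -> nat -> R) (x : 'cV[R]_2) : R :=
  \sum_(i < m.+1) \sum_(j < m.+1 | (i + j <= m)%N) x 0 0 ^+ i * x 1 0 ^+ j * c i j.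

Definition coef_d {R : realType} (a : 'I_2) (c : nat -> nat -> R) i j : R :=
  if a == 0 then i.+1%:R * c i.+1 j else j.+1%:R * c i j.+1.

Section Poly2.
Context {R : realType}.
Implicit Types (c d : nat -> nat -> R) (x v : 'cV[R]_2).

Lemma eq_poly2 m c d x :
  (forall i j, (i + j <= m)%N -> c i j = d i j) -> poly2 m c x = poly2 m d x.
Proof. by move=> cd; apply: eq_bigr => i _; apply: eq_bigr => j /cd ->. Qed.

Lemma poly2_0 m x : poly2 m (fun _ _ => 0) x = 0.
Proof. by rewrite /poly2 big1 // => i _; rewrite big1 // => j _; rewrite mulr0. Qed.

Lemma poly2D m c d x :
  poly2 m c x + poly2 m d x = poly2 m (fun i j => c i j + d i j) x.
Proof.
rewrite /poly2 -big_split; apply: eq_bigr => i _; rewrite -big_split.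
by apply: eq_bigr => j _; rewrite mulrDr.
Qed.

Lemma poly2Z m (b : R) c x : b * poly2 m c x = poly2 m (fun i j => b * c i j) x.
Proof.
rewrite /poly2 mulr_sumr; apply: eq_bigr => i _; rewrite mulr_sumr.
by apply: eq_bigr => j _; rewrite mulrCA.
Qed.

Lemma poly2_at0 m c : poly2 m c 0 = c 0 0.
Proof.
rewrite /poly2 big_ord_recl big_mkcond big_ord_recl /= !mxE !expr0 !mul1r.
rewrite big1 ?addr0 => [|j _]; last first.
  by rewrite ?mxE exprS !(mul0r, mulr0) if_same.
rewrite big1 ?addr0 // => i _; rewrite big1 // => j _.
by rewrite ?mxE exprS !mul0r.
Qed.

Lemma is_derive_poly2 m c x v :
  is_derive x v (poly2 m c)
   (\sum_(i < m.+1) \sum_(j < m.+1 | (i + j <= m)%N)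
     (i%:R * x 0 0 ^+ i.-1 * v 0 0 * x 1 0 ^+ j
      + x 0 0 ^+ i * (j%:R * x 1 0 ^+ j.-1 * v 1 0)) * c i j).
Proof.
(* The triangular sum becomes a full square with zero coefficients outside, written as a combination
   of functions, so that the rules for sums, products and powers apply. *)
have -> : poly2 m c = \sum_(i < m.+1) \sum_(j < m.+1)
    (if (i + j <= m)%N then c i j else 0) \*:
    ((fun y : 'cV[R]_2 => y 0 0) ^+ i * (fun y : 'cV[R]_2 => y 1 0) ^+ j).
  apply/funext => y; rewrite fct_sumE; apply: eq_bigr => i _.
  rewrite fct_sumE big_mkcond; apply: eq_bigr => j _.
  rewrite !fctE /= /GRing.scale /=; case: ifP => _; last by rewrite mul0r.
  by rewrite mulrC.
apply: is_derive_eq.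
  apply: is_derive_sum => i; apply: is_derive_sum => j.
  apply: is_deriveZ; apply: is_deriveM; apply: is_deriveX; exact: is_derive_coord.
apply: eq_bigr => i _; rewrite [RHS]big_mkcond; apply: eq_bigr => j _.
rewrite !fctE /= /GRing.scale /=; case: ifP => _; last by rewrite mul0r.
by ring.
Qed.

Lemma partial_poly2 a m c x :
  partial a (poly2 m.+1 c) x = poly2 m (coef_d a c) x.
Proof.
rewrite /partial; have [_ ->] := is_derive_poly2 m.+1 c x (delta_mx a 0).
have [->|->] := ord2P a.
  (* Along [x_1] the row [i = 0] is killed; after the index shift the last column exceeds the degree
     bound. *)
  rewrite big_ord_recl /= big1 ?add0r => [|j _]; last first.
    by rewrite !mxE /=; ring.
  apply: eq_bigr => i _; rewrite [LHS]big_mkcond big_ord_recr /= [RHS]big_mkcond /=.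
  rewrite /bump leq0n add1n ifF ?addr0; last by lia.
  apply: eq_bigr => j _; rewrite addSn ltnS; case: ifP => // _.
  by rewrite /coef_d !mxE /=; ring.
(* Along [x_2] the degree bound cuts the last row down to [j = 0], whose derivative vanishes; the
   other rows lose their column [j = 0]. *)
rewrite big_ord_recr /= [X in _ + X]big1 ?addr0 => [|j jm]; last first.
  have -> : (j : nat) = 0 by lia.
  by rewrite !mxE /=; ring.
apply: eq_bigr => i _; rewrite [LHS]big_mkcond big_ord_recl /= [RHS]big_mkcond /=.
rewrite [X in X + _](_ : _ = 0) ?add0r; last first.
  by rewrite !mxE /=; case: ifP => // _; ring.
apply: eq_bigr => j _; rewrite /bump leq0n add1n addnS ltnS; case: ifP => // _.
by rewrite /coef_d !mxE /=; ring.
Qed.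

(** Openness turns equality on [D] into equality near each of its points. *)
Lemma partial_ext (D : set 'cV[R]_2) (a : 'I_2) (f g : 'cV[R]_2 -> R) :
  open D -> {in D, f =1 g} -> {in D, partial a f =1 partial a g}.
Proof.
move=> oD fg x /set_mem Dx; apply: near_eq_derive.
near=> y; apply: fg; apply/mem_set; near: y; exact: open_nbhs_nbhs.
Unshelve. all: by end_near. Qed.

(** Induction on the degree: both partial derivatives agree on [D] and determine every nonconstant
    coefficient up to a nonzero integer factor; the constant one is the value at the origin. *)
Lemma poly2_inj (D : set 'cV[R]_2) m c d : open D -> D 0 ->
  {in D, poly2 m c =1 poly2 m d} -> forall i j, (i + j <= m)%N -> c i j = d i j.
Proof.
move=> oD D0; elim: m c d => [|m IH] c d cd i j ij.
  have [-> ->] : i = 0 /\ j = 0 by lia.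
  by rewrite -(poly2_at0 0 c) -(poly2_at0 0 d); apply: cd; exact/mem_set.
have dcd a : {in D, poly2 m (coef_d a c) =1 poly2 m (coef_d a d)}.
  by move=> x Dx; rewrite -!partial_poly2; exact: partial_ext cd x Dx.
case: i ij => [|i] ij; last first.
  by have := IH _ _ (dcd 0) i j ij; rewrite /coef_d /=; apply: mulfI; rewrite pnatr_eq0.
case: j ij => [|j] ij; last first.
  by have := IH _ _ (dcd 1) 0 j ij; rewrite /coef_d /=; apply: mulfI; rewrite pnatr_eq0.
by rewrite -(poly2_at0 m.+1 c) -(poly2_at0 m.+1 d); apply: cd; exact/mem_set.
Qed.

End Poly2.

(** * The operators of the complex on coefficients *)

Definition poly2_mx_on {R : realType} {p q : nat} (D : set 'cV[R]_2) m
    (C : nat -> nat -> 'M[R]_(p, q)) (f : 'cV[R]_2 -> 'M[R]_(p, q)) : Prop :=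
  forall x, x \in D -> forall a b, f x a b = poly2 m (fun i j => C i j a b) x.

Definition coef_sym_curl {R : realType} (V : nat -> nat -> 'cV[R]_2) i j : 'M[R]_2 :=
  let A := \matrix_(a, b) (if b == 0 then coef_d 1 (fun i j => V i j a 0) i j
                           else - coef_d 0 (fun i j => V i j a 0) i j) in
  2^-1 *: (A + A^T).

Definition coef_div_div {R : realType} (T : nat -> nat -> 'M[R]_2) : nat -> nat -> R :=
  fun i j => \sum_b coef_d b (fun i j => \sum_a coef_d a (fun i j => T i j b a) i j) i j.

Definition coef_RT {R : realType} (a : 'cV[R]_2) (b : R) (i j : nat) : 'cV[R]_2 :=
  match i, j with
  | 0%N, 0%N => a
  | 1%N, 0%N => b *: delta_mx 0 0
  | 0%N, 1%N => b *: delta_mx 1 0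
  | _, _ => 0
  end.

Section Operators.
Context {R : realType} {D : set 'cV[R]_2}.
Implicit Types (V : nat -> nat -> 'cV[R]_2) (T : nat -> nat -> 'M[R]_2).

(** Reading entrywise reduces vector fields ([q = 1]) and matrix fields alike to scalar
    polynomials. *)
Lemma PolyOn_mxP p q m (X : set 'M[R]_(p, q)) (f : 'cV[R]_2 -> 'M[R]_(p, q)) :
  PolyOn m D X f <-> exists C, (forall i j, X (C i j)) /\ poly2_mx_on D m C f.
Proof.
have E (C : nat -> nat -> _) (x : 'cV[R]_2) a b : (\sum_(i < m.+1) \sum_(j < m.+1 | (i + j <= m)%N)
    (x 0 0 ^+ i * x 1 0 ^+ j) *: (C i j : 'M[R]_(p, q))) a b =
    poly2 m (fun i j => C i j a b) x.
  rewrite summxE; apply: eq_bigr => i _; rewrite summxE.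
  by apply: eq_bigr => j _; rewrite mxE.
split=> -[C [XC fC]]; exists C; split=> // x Dx.
  by move=> a b; rewrite fC// E.
by apply/matrixP => a b; rewrite fC// E.
Qed.

Lemma symmetric_matricesP (A : 'M[R]_2) :
  symmetric_matrices A <-> A 0 1 = A 1 0.
Proof.
rewrite /symmetric_matrices /= is_hermitianmxE expr0 scale1r.
split=> [/eqP {1}->|A01]; first by rewrite !mxE.
by apply/eqP/matrixP => a b; rewrite !mxE; have [->|->] := ord2P a; have [->|->] := ord2P b.
Qed.

Lemma coef_sym_curl_symmetric V i j : symmetric_matrices (coef_sym_curl V i j).
Proof. by apply/symmetric_matricesP; rewrite !mxE /= addrC. Qed.

Lemma poly2_sym_curl m V v : open D -> poly2_mx_on D m.+1 V v ->
  poly2_mx_on D m (coef_sym_curl V) (sym_curl v).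
Proof.
move=> oD vV.
have E e a x : x \in D -> partial e (fun y => v y a 0) x =
    poly2 m (coef_d e (fun i j => V i j a 0)) x.
  move=> Dx; rewrite -partial_poly2; apply: (partial_ext _ _ _ _ oD) Dx => y Dy.
  exact: vV.
have N x c : - poly2 m c x = poly2 m (fun i j => - c i j) x.
  by rewrite -mulN1r poly2Z; apply: eq_poly2 => i j _; rewrite mulN1r.
move=> x Dx a b; rewrite !mxE !E//.
under [RHS]eq_poly2 do rewrite !mxE.
have [->|->] := ord2P a; have [->|->] := ord2P b => /=;
  by rewrite ?N poly2D poly2Z.
Qed.

Lemma poly2_div_div m T tau : open D -> poly2_mx_on D m.+2 T tau ->
  {in D, div_div tau =1 poly2 m (coef_div_div T)}.
Proof.
move=> oD tT.
(* The row-wise divergence is itself polynomial on [D], which allows the same replacement under the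
   second derivative. *)
have E b y : y \in D -> div_rows tau y b 0 =
    poly2 m.+1 (fun i j => \sum_a coef_d a (fun i j => T i j b a) i j) y.
  move=> Dy; rewrite mxE /div sum_ord2.
  under [RHS]eq_poly2 do rewrite sum_ord2.
  rewrite -poly2D -!partial_poly2; congr (_ + _);
    by apply: (partial_ext _ _ _ _ oD) Dy => z Dz; rewrite !mxE tT.
move=> x Dx; rewrite /div_div /div sum_ord2.
under [RHS]eq_poly2 do rewrite /coef_div_div sum_ord2.
rewrite -poly2D -!partial_poly2; congr (_ + _);
  by apply: (partial_ext _ _ _ _ oD) Dx => z Dz; rewrite E.
Qed.

(** The diagonal entries are [d_2 v_1] and [- d_1 v_2], the off-diagonal one is
    [(d_2 v_2 - d_1 v_1) / 2]; the third-order terms cancel because formal derivatives commute. *)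
Lemma coef_div_div_sym_curl V i j : coef_div_div (coef_sym_curl V) i j = 0.
Proof.
rewrite /coef_div_div !sum_ord2 /coef_d /= !sum_ord2 /= /coef_sym_curl !mxE /coef_d /=.
by field.
Qed.

Lemma poly2_RT m a (b : R) : poly2_mx_on D m.+1 (coef_RT a b) (fun x => a + b *: x).
Proof.
move=> x _ p q; rewrite (ord1 q) {q}.
(* Only the pairs (0,0), (0,1) and (1,0) carry coefficients, and a degree bound of at least 1 admits
   all of them. *)
have S (i : 'I_m.+2) : \sum_(j < m.+2 | (i + j <= m.+1)%N)
      x 0 0 ^+ i * x 1 0 ^+ j * coef_RT a b i j p 0 =
    match i : nat with
    | 0%N => a p 0 + x 1 0 * (b *: delta_mx 1 0 : 'cV[R]_2) p 0
    | 1%N => x 0 0 * (b *: delta_mx 0 0 : 'cV[R]_2) p 0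
    | _ => 0
    end.
  rewrite big_mkcond 2!big_ord_recl /= big1 ?addr0 => [|j _]; last first.
    by case: (i : nat) => [|[|?]]; rewrite /= mxE mulr0 if_same.
  case: i => -[|[|i]] im /=; rewrite ?mxE ?mulr0 ?if_same ?addr0 //.
  - by rewrite !(expr0, expr1, mul1r).
  - by rewrite !(expr0, expr1, mul1r, mulr1).
rewrite /poly2 (eq_bigr _ (fun i _ => S i)) 2!big_ord_recl /= big1 // addr0.
by have [->|->] := ord2P p; rewrite !mxE /=; ring.
Qed.

(** * Kernel and image of the symmetrized curl on coefficients *)

Lemma coef_sym_curl_RT a (b : R) i j : coef_sym_curl (coef_RT a b) i j = 0.
Proof.
apply/matrixP => p q; rewrite !mxE /coef_d /=.
case: i => [|[|i]]; case: j => [|[|j]]; have [->|->] := ord2P p;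
  have [->|->] := ord2P q; rewrite /= !mxE /=; ring.
Qed.

(** The diagonal makes [v_1] a function of [x_1] alone and [v_2] of [x_2] alone; the off-diagonal
    entry equates [d_1 v_1] with [d_2 v_2], so both are one constant, the [b] of the Raviart-Thomas
    field. *)
Lemma coef_sym_curl_ker m V :
  (forall i j, (i + j <= m)%N -> coef_sym_curl V i j = 0) ->
  forall i j, (i + j <= m.+1)%N -> V i j = coef_RT (V 0%N 0%N) (V 1%N 0%N 0 0) i j.
Proof.
move=> V0.
have E00 i j : (i + j <= m)%N -> V i j.+1 0 0 = 0.
  move=> /V0/matrixP/(_ 0 0); rewrite !mxE /coef_d /= => E.
  have : j.+1%:R * V i j.+1 0 0 = 0 by lra.
  by move=> /eqP; rewrite mulf_eq0 pnatr_eq0 => /eqP.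
have E11 i j : (i + j <= m)%N -> V i.+1 j 1 0 = 0.
  move=> /V0/matrixP/(_ 1 1); rewrite !mxE /coef_d /= => E.
  have : i.+1%:R * V i.+1 j 1 0 = 0 by lra.
  by move=> /eqP; rewrite mulf_eq0 pnatr_eq0 => /eqP.
have E01 i j : (i + j <= m)%N -> j.+1%:R * V i j.+1 1 0 = i.+1%:R * V i.+1 j 0 0.
  by move=> /V0/matrixP/(_ 0 1); rewrite !mxE /coef_d /=; lra.
(* For pure powers of degree at least 2, one side of [E01] is a mixed coefficient already known to
   vanish. *)
have E10 i : (i.+1 <= m)%N -> V i.+2 0%N 0 0 = 0.
  move=> im; have := E01 i.+1 0%N; rewrite addn0 => /(_ im).
  rewrite E11 ?mulr0; last by lia.
  by move=> /esym/eqP; rewrite mulf_eq0 pnatr_eq0 => /eqP.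
have E02 j : (j.+1 <= m)%N -> V 0%N j.+2 1 0 = 0.
  move=> jm; have := E01 0%N j.+1 jm; rewrite E00 ?mulr0; last by lia.
  by move=> /eqP; rewrite mulf_eq0 pnatr_eq0 => /eqP.
move=> i j ij; apply/matrixP => p q; rewrite (ord1 q) {q}.
have [->|->] := ord2P p; case: i ij => [|i] ij; case: j ij => [|j] ij //=.
- by rewrite E00//; case: j ij => *; rewrite !mxE /= ?mulr0.
- case: i ij => [|i] ij; rewrite !mxE /= ?mulr1// E10//; lia.
- by rewrite E00; [case: i ij => *; rewrite !mxE | lia].
- case: j ij => [|j] ij; rewrite !mxE /= ?mulr1.
  by have := E01 0%N 0%N isT; rewrite !mul1r.
  by rewrite E02.
- by rewrite E11; [case: i ij => *; rewrite !mxE /= ?mulr0 | lia].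
- by rewrite E11; [case: i ij => *; rewrite !mxE | lia].
Qed.

(** Three entries give three recurrences for two unknown families; the vanishing of [coef_div_div T]
    is their compatibility condition. *)
Lemma coef_sym_curl_onto m T : (forall i j, symmetric_matrices (T i j)) ->
  (forall i j, (i + j <= m)%N -> coef_div_div T i j = 0) ->
  exists V, forall i j, (i + j <= m.+2)%N -> coef_sym_curl V i j = T i j.
Proof.
move=> Tsym T0.
(* The diagonal entries determine all coefficients of [V] but those of the pure
   powers [x_1 ^ i] in the first component and [x_2 ^ j] in the second one,
   which are then fixed by the off-diagonal entry; in [v2 0 1] the junk value of
   the division by [0] is the required [0]. *)
pose v1 i j : R := match i, j with
  | _, j.+1 => T i j 0 0 / j.+1%:R
  | i.+2, 0%N => (- T i 1%N 1 1 / i.+1%:R - 2 * T i.+1 0%N 0 1) / i.+2%:R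
  | _, 0%N => 0
  end.
pose v2 i j : R := match i, j with
  | i.+1, _ => - T i j 1 1 / i.+1%:R
  | 0%N, j.+1 => (2 * T 0%N j 0 1 + T 1%N j.-1 0 0 / j%:R) / j.+1%:R
  | 0%N, 0%N => 0
  end.
exists (fun i j => \col_a if a == 0 then v1 i j else v2 i j) => i j ij.
have v1E : j.+1%:R * v1 i j.+1 = T i j 0 0.
  by case: i ij => [|[|i]] ij; rewrite /v1 mulrC divfK// pnatr_eq0.
have v2E : i.+1%:R * v2 i.+1 j = - T i j 1 1.
  by rewrite /v2 mulrC divfK// pnatr_eq0.
(* On the border [i = 0] or [j = 0] this is how the pure powers were chosen. *)
have v12E : j.+1%:R * v2 i j.+1 - i.+1%:R * v1 i.+1 j = 2 * T i j 0 1.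
  case: i j ij {v1E v2E} => [|i] [|j] ij; rewrite /v1 /v2.
  - by rewrite invr0; field.
  - by field; rewrite nat1r -natrD !pnatr_eq0.
  - by field; rewrite nat1r -natrD !pnatr_eq0.
  (* In the interior, the equation at [(i.+1, j.+1)] cleared of denominators is the hypothesis at
     [(i, j)], the two mixed terms being merged by symmetry. *)
  have := T0 i j; rewrite /coef_div_div !sum_ord2 /coef_d /= !sum_ord2 /=.
  have /symmetric_matricesP -> := Tsym i.+1 j.+1.
  move=> /(_ ltac:(lia)) E.
  apply: (@mulfI _ (i.+1%:R * j.+1%:R)); first by rewrite mulf_neq0 ?pnatr_eq0.
  transitivity (- (i.+1%:R * i.+2%:R * T i.+2 j 0 0 + j.+1%:R * j.+2%:R * T i j.+2 1 1)).
    by field; rewrite !nat1r !pnatr_eq0.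
  by rewrite -[RHS]subr0 -E; ring.
have T10 : T i j 1 0 = T i j 0 1 by apply/esym/symmetric_matricesP.
clearbody v1 v2; apply/matrixP => p q; rewrite !mxE /coef_d.
have [->|->] := ord2P p; have [->|->] := ord2P q; rewrite /= !mxE /= ?T10; lra.
Qed.

End Operators.

(** * Exactness for polynomial fields on the domain *)

Theorem lemma3p1 (R : realType) (D : set 'cV[R]_2) (k : nat)
    (D_domain : domain D) (D_sc : simply_connected R D)
    (D_bounded : bounded_set D) (D_origin : D 0) (k_ge2 : (2 <= k)%N) :
  let P_vec := PolyOn k.+1 D (@setT 'cV[R]_2) in
  let P_sym := PolyOn k D (@symmetric_matrices R) in
  let P_scal := PolyOn (k - 2) D (@setT R^o) in
  [/\
      [/\ RT D `<=` P_vec,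
          forall v, P_vec v -> P_sym (sym_curl v)
        & forall tau, P_sym tau -> P_scal (div_div tau)],
      [/\ forall v, RT D v -> {in D, sym_curl v =1 fun=> 0}
        & forall v, P_vec v -> {in D, div_div (sym_curl v) =1 fun=> 0}],
      kernel_on D P_vec (@sym_curl R) = RT D,
      kernel_on (W := R^o) D P_sym (@div_div R) =
        range_on D P_vec (@sym_curl R)
    & range_on (W := R^o) D P_sym (@div_div R) = P_scal].
Proof.
have [oD _ _] := D_domain.
(* With [k = n.+2] the degrees are [n.+3], [n.+2] and [n], free of truncated subtraction. *)
case: k k_ge2 => [//|[//|n] _]; rewrite subSS subSS subn0 => P_vec P_sym P_scal.
have P_vecP v : P_vec v <-> exists V, poly2_mx_on D n.+3 V v.
  by rewrite /P_vec PolyOn_mxP; split=> [[V []]|[V vV]]; exists V.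
have P_symP tau : P_sym tau <->
    exists T, (forall i j, symmetric_matrices (T i j)) /\ poly2_mx_on D n.+2 T tau.
  by rewrite /P_sym PolyOn_mxP.
have P_scalP g : P_scal g <-> exists c, {in D, g =1 poly2 n c}.
  by split=> [[c []]|[c gc]]; exists c.
have RT_vec v : RT D v -> exists a b, poly2_mx_on D n.+3 (coef_RT a b) v.
  by move=> [a [b vE]]; exists a, b => x Dx p q; rewrite vE// (poly2_RT n.+2 _ _ x Dx).
have curl0 v : RT D v -> {in D, sym_curl v =1 fun=> 0}.
  move=> /RT_vec[a [b vV]] x Dx; apply/matrixP => p q.
  rewrite (poly2_sym_curl _ _ _ oD vV _ Dx) mxE -(poly2_0 n.+2 x).
  by apply: eq_poly2 => i j _; rewrite coef_sym_curl_RT mxE.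
have curl_sym v : P_vec v -> P_sym (sym_curl v).
  move=> /P_vecP[V vV]; apply/P_symP; exists (coef_sym_curl V).
  by split; [exact: coef_sym_curl_symmetric | exact: poly2_sym_curl].
have div_scal tau : P_sym tau -> P_scal (div_div tau).
  move=> /P_symP[T [_ tT]]; apply/P_scalP; exists (coef_div_div T).
  exact: poly2_div_div.
have div_curl v : P_vec v -> {in D, div_div (sym_curl v) =1 fun=> 0}.
  move=> /P_vecP[V vV] x Dx.
  rewrite (poly2_div_div _ _ _ oD (poly2_sym_curl _ _ _ oD vV)) // -(poly2_0 n x).
  by apply: eq_poly2 => i j _; exact: coef_div_div_sym_curl.
have RT_sub : RT D `<=` P_vec.
  by move=> v /RT_vec[a [b vV]]; apply/P_vecP; exists (coef_RT a b).
split=> //.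
- apply/seteqP; split=> [v [/P_vecP[V vV] v0]|v vRT]; last first.
    by split; [exact: RT_sub|exact: curl0].
  (* Uniqueness of coefficients, entry by entry, turns the vanishing of the field on [D] into
     recurrences. *)
  have V0 i j : (i + j <= n.+2)%N -> coef_sym_curl V i j = 0.
    move=> ij; apply/matrixP => p q; rewrite [RHS]mxE.
    apply: (poly2_inj _ _ (fun i j => coef_sym_curl V i j p q) (fun _ _ => 0)
      oD D_origin) ij => x Dx.
    by rewrite -(poly2_sym_curl _ _ _ oD vV _ Dx) v0// mxE poly2_0.
  exists (V 0%N 0%N), (V 1%N 0%N 0 0) => x Dx; apply/matrixP => p q.
  rewrite vV// (poly2_RT n.+2 _ _ _ Dx); apply: eq_poly2 => i j ij.
  by rewrite (coef_sym_curl_ker _ _ V0 _ _ ij).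
- apply/seteqP; split=> [tau [/P_symP[T [Tsym tT]] tau0]|tau [v vP tv]].
    have T0 i j : (i + j <= n)%N -> coef_div_div T i j = 0.
      move: i j; apply: (poly2_inj _ _ _ (fun _ _ => 0) oD D_origin) => x Dx.
      by rewrite -(poly2_div_div _ _ _ oD tT _ Dx) tau0// poly2_0.
    have [V VT] := coef_sym_curl_onto _ _ Tsym T0.
    pose v x : 'cV[R]_2 := \col_a poly2 n.+3 (fun i j => V i j a 0) x.
    have vV : poly2_mx_on D n.+3 V v by move=> x _ a b; rewrite mxE (ord1 b).
    exists v => [|x Dx]; first by apply/P_vecP; exists V.
    apply/matrixP => p q; rewrite tT// (poly2_sym_curl _ _ _ oD vV _ Dx).
    by apply: eq_poly2 => i j ij; rewrite VT.
  (* [tau] equals [sym_curl v] only on [D]; a common coefficient family [W] transfers the vanishing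
     of [div_div] to [tau]. *)
  have [W [Wsym vW]] := (P_symP _).1 (curl_sym _ vP).
  split; first by apply/P_symP; exists W; split=> // x Dx p q; rewrite tv// vW.
  have tW : poly2_mx_on D n.+2 W tau by move=> x Dx p q; rewrite tv// vW.
  move=> x Dx; rewrite (poly2_div_div _ _ _ oD tW _ Dx).
  by rewrite -(poly2_div_div _ _ _ oD vW _ Dx) div_curl.
- apply/seteqP; split=> [g [tau /div_scal/P_scalP[c tc] gt]|g /P_scalP[c gc]].
    by apply/P_scalP; exists c => x Dx; rewrite gt// tc.
  (* A preimage comes from integrating twice in [x_1] and placing the result in the entry [0 0]. For
     [i < 2] the divisor is 0, hence the quotient is 0 too. *)
  pose t i j := c (i - 2)%N j / (i%:R * i.-1%:R).
  pose T i j : 'M[R]_2 := t i j *: delta_mx 0 0.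
  pose tau x : 'M[R]_2 := \matrix_(a, b) poly2 n.+2 (fun i j => T i j a b) x.
  have tT : poly2_mx_on D n.+2 T tau by move=> x _ a b; rewrite mxE.
  exists tau => [|x Dx].
    by apply/P_symP; exists T; split=> // i j; apply/symmetric_matricesP; rewrite !mxE.
  rewrite gc// (poly2_div_div _ _ _ oD tT _ Dx); apply: eq_poly2 => i j _.
  rewrite /coef_div_div !sum_ord2 /coef_d /= !sum_ord2 /= !mxE /= /t.
  rewrite subSS subSS subn0 /= !(mulr0, addr0, mulr1).
  by field; rewrite nat1r -natrD !pnatr_eq0.
Qed.
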